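(* Let $\mathbb{D}\in\{\mathbb{R},\mathbb{C},\mathbb{H}\}$ and let $(A,B)\in\mathscr{P}_n(\mathbb{D})^2$. Let $\sigma$ be a Kubo-Ando mean on $\mathscr{P}_n(\mathbb{D})$ whose representing function $f$ is not affine. Then $A\,\sigma\,B$ is linearizable if and only if $|\mathrm{Spec}(A^{-1}B)|\leq 2$.
   Context: $\mathscr{P}_n(\mathbb{D})$ is the set of $n\times n$ matrices $A$ over $\mathbb{D}$ that are Hermitian ($A=A^*$, with $A^*$ the conjugate transpose) and positive ($x^*Ax>0$ for all nonzero $x\in\mathbb{D}^n$). $\mathrm{Spec}(X)$ is the set of eigenvalues of $X$ (right eigenvalues $\lambda$, $Xv=v\lambda$ with $v\neq 0$, when $\mathbb{D}=\mathbb{H}$), without multiplicity; for $A,B\in\mathscr{P}_n(\mathbb{D})$ one has $\mathrm{Spec}(A^{-1}B)=\mathrm{Spec}(A^{-1/2}BA^{-1/2})\subset(0,\infty)$. For a continuous $f:(0,\infty)\to\mathbb{R}$ and $X=U\,\mathrm{diag}(\lambda_1,\dots,\lambda_n)\,U^*\in\mathscr{P}_n(\mathbb{D})$ with $UU^*=\mathrm{Id}_n$, set $f(X)=U\,\mathrm{diag}(f(\lambda_1),\dots,f(\lambda_n))\,U^*$. A Kubo-Ando mean on $\mathscr{P}_n(\mathbb{D})$ is a continuous map $\sigma:\mathscr{P}_n(\mathbb{D})\times\mathscr{P}_n(\mathbb{D})\to\mathscr{P}_n(\mathbb{D})$ that is monotone in both arguments for the Loewner order, satisfies $g(A\,\sigma\,B)g^*=(gAg^*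 )\,\sigma\,(gBg^* )$ for all $g\in\mathrm{GL}_n(\mathbb{D})$, and satisfies $\mathrm{Id}_n\,\sigma\,\mathrm{Id}_n=\mathrm{Id}_n$. By the Kubo-Ando correspondence, used throughout, it is given by $A\,\sigma\,B=A^{1/2}f(A^{-1/2}BA^{-1/2})A^{1/2}$ for a unique operator monotone function $f:(0,\infty)\to(0,\infty)$ with $f(1)=1$, called its representing function. $A\,\sigma\,B$ is called linearizable if there exist $a,b\in\mathbb{R}$ with $A\,\sigma\,B=aA+bB$. *)

(* Defs.v *)
From HB Require Import structures.
From mathcomp Require Import all_boot all_order all_algebra.
From mathcomp Require Import complex ring.
From mathcomp Require Import all_classical all_reals all_analysis.
Set Implicit Arguments.
Unset Strict Implicit.
Unset Printing Implicit Defensive.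
Import Order.TTheory GRing.Theory Num.Theory.
Import numFieldTopology.Exports numFieldNormedType.Exports.

Local Open Scope classical_set_scope.
Local Open Scope ring_scope.

#[short(type="topNzRingType")]
HB.structure Definition TopNzRing := {T of Topological T & GRing.NzRing T}.

(* Quat a b c d stands for a + b i + c j + d k. *)
Record quat (R : Type) := Quat { qre : R; qi : R; qj : R; qk : R }.

Section QuatRing.
Variable R : realType.
Implicit Types x y z : quat R.

Definition quat_coords x : R * R * R * R := (qre x, qi x, qj x, qk x).
Definition quat_of_coords (t : R * R * R * R) : quat R :=
  let: (a, b, c, d) := t in Quat a b c d.

Lemma quat_coordsK : cancel quat_coords quat_of_coords.
Proof. by case. Qed.

HB.instance Definition _ := Choice.copy (quat R) (can_type quat_coordsK).

Definition addq x y :=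
  Quat (qre x + qre y) (qi x + qi y) (qj x + qj y) (qk x + qk y).
Definition oppq x := Quat (- qre x) (- qi x) (- qj x) (- qk x).
Definition zeroq : quat R := Quat 0 0 0 0.
Definition oneq : quat R := Quat 1 0 0 0.
Definition mulq x y :=
  let: Quat a1 b1 c1 d1 := x in
  let: Quat a2 b2 c2 d2 := y in
  Quat (a1 * a2 - b1 * b2 - c1 * c2 - d1 * d2)
       (a1 * b2 + b1 * a2 + c1 * d2 - d1 * c2)
       (a1 * c2 - b1 * d2 + c1 * a2 + d1 * b2)
       (a1 * d2 + b1 * c2 - c1 * b2 + d1 * a2).
Definition conjq x := Quat (qre x) (- qi x) (- qj x) (- qk x).
Definition quat_of_real (a : R) : quat R := Quat a 0 0 0.

Lemma addqA : associative addq.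
Proof. by move=> x y z; congr Quat; rewrite /= addrA. Qed.
Lemma addqC : commutative addq.
Proof. by move=> x y; congr Quat; rewrite /= addrC. Qed.
Lemma add0q : left_id zeroq addq.
Proof. by case=> a b c d; congr Quat; rewrite /= add0r. Qed.
Lemma addNq : left_inverse zeroq oppq addq.
Proof. by move=> x; congr Quat; rewrite /= addNr. Qed.

HB.instance Definition _ := GRing.isZmodule.Build (quat R) addqA addqC add0q addNq.

Lemma mulqA : associative mulq.
Proof. by case=> ? ? ? ? [? ? ? ?] [? ? ? ?]; congr Quat => /=; ring. Qed.
Lemma mul1q : left_id oneq mulq.
Proof. by case=> ? ? ? ?; congr Quat => /=; ring. Qed.
Lemma mulq1 : right_id oneq mulq.
Proof. by case=> ? ? ? ?; congr Quat => /=; ring. Qed.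
Lemma mulqDl : left_distributive mulq +%R.
Proof. by case=> ? ? ? ? [? ? ? ?] [? ? ? ?]; congr Quat => /=; ring. Qed.
Lemma mulqDr : right_distributive mulq +%R.
Proof. by case=> ? ? ? ? [? ? ? ?] [? ? ? ?]; congr Quat => /=; ring. Qed.
Lemma oneq_neq0 : oneq != 0.
Proof. by apply/eqP => -[] /eqP; rewrite oner_eq0. Qed.

HB.instance Definition _ := GRing.Zmodule_isNzRing.Build (quat R)
  mulqA mul1q mulq1 mulqDl mulqDr oneq_neq0.

HB.instance Definition _ :=
  Topological.copy (quat R) (initial_topology quat_coords).

End QuatRing.

HB.instance Definition _ (K : numFieldType) := Topological.on K^o.

(* A topological ring with a conjugation and an embedding of R.  The record
   carries no axioms: it is only instantiated at the three algebras below. *)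
Record scalars (R : realType) := Scalars {
  scalar :> topNzRingType;
  sconj : scalar -> scalar;
  of_real : R -> scalar }.

Inductive algebra_kind := Reals | Complexes | Quaternions.

(* K^o is the field K with the topology of its norm. *)
Definition scalars_of (R : realType) (k : algebra_kind) : scalars R :=
  match k with
  | Reals => @Scalars R R^o id id
  | Complexes => @Scalars R R[i]^o conjc (real_complex R)
  | Quaternions => @Scalars R (quat R) (@conjq R) (@quat_of_real R)
  end.

Section Matrices.
Variables (R : realType) (D : scalars R).

Definition ctransmx m n (A : 'M[D]_(m, n)) : 'M[D]_(n, m) := (map_mx (@sconj R D) A)^T.

Definition qform n (A : 'M[D]_n) (x : 'cV[D]_n) : D := (ctransmx x *m A *m x) 0 0.

Definition hermitian n (A : 'M[D]_n) : Prop := ctransmx A = A.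

Definition posdef n (A : 'M[D]_n) : Prop :=
  hermitian A /\
  forall x : 'cV[D]_n, x != 0 -> exists2 r : R, 0 < r & qform A x = of_real D r.

Definition loewner n (A B : 'M[D]_n) : Prop :=
  forall x : 'cV[D]_n, exists2 r : R, 0 <= r & qform (B - A) x = of_real D r.

Definition inverse_of n (A X : 'M[D]_n) : Prop := A *m X = 1%:M /\ X *m A = 1%:M.

(* The library's invmx needs commutative scalars.  Junk value 0 when A is
   not invertible. *)
Definition minv n (A : 'M[D]_n) : 'M[D]_n := xget 0 [set X | inverse_of A X].

(* Scalars act on column vectors on the right: X v = v lambda. *)
Definition Spec n (X : 'M[D]_n) : set D :=
  [set lambda | exists2 v : 'cV[D]_n, v != 0 & X *m v = v *m lambda%:M].

Definition real_diag n (l : 'rV[R]_n) : 'M[D]_n := diag_mx (map_mx (of_real D) l).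

Definition diagonalizes n (X : 'M[D]_n) (p : 'M[D]_n * 'rV[R]_n) : Prop :=
  p.1 *m ctransmx p.1 = 1%:M /\ X = p.1 *m real_diag p.2 *m ctransmx p.1.

(* f(X) for X unitarily diagonalizable with real eigenvalues; the value does
   not depend on the diagonalization that is picked. *)
Definition mfun (f : R -> R) n (X : 'M[D]_n) : 'M[D]_n :=
  let p := xget (1%:M, 0) [set p | diagonalizes X p] in
  p.1 *m real_diag (map_mx f p.2) *m ctransmx p.1.

Definition msqrt n (A : 'M[D]_n) : 'M[D]_n := mfun Num.sqrt A.
Definition misqrt n (A : 'M[D]_n) : 'M[D]_n := mfun (fun t => (Num.sqrt t)^-1) A.

(* A mean is a total function on matrices, only its values on positive
   definite arguments matter. *)
Record kubo_ando_mean n (sigma : 'M[D]_n -> 'M[D]_n -> 'M[D]_n) : Prop :=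
  KuboAndoMean {
    mean_posdef : forall A B, posdef A -> posdef B -> posdef (sigma A B);
    mean_continuous :
      {within [set p : 'M[D]_n * 'M[D]_n | posdef p.1 /\ posdef p.2],
        continuous (fun p => sigma p.1 p.2)};
    mean_monotone : forall A A' B B',
      posdef A -> posdef A' -> posdef B -> posdef B' ->
      loewner A A' -> loewner B B' -> loewner (sigma A B) (sigma A' B');
    mean_congruence : forall g A B,
      (exists h, inverse_of g h) -> posdef A -> posdef B ->
      g *m sigma A B *m ctransmx g = sigma (g *m A *m ctransmx g) (g *m B *m ctransmx g);
    mean_normalized : sigma 1%:M 1%:M = 1%:M }.

Definition linearizable n (sigma : 'M[D]_n -> 'M[D]_n -> 'M[D]_n)
    (A B : 'M[D]_n) : Prop :=
  exists a b : R, sigma A B = of_real D a *: A + of_real D b *: B.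

End Matrices.

(* Monotone on complex positive definite matrices of every order. *)
Definition operator_monotone (R : realType) (f : R -> R) : Prop :=
  forall m (X Y : 'M[scalars_of R Complexes]_m),
    posdef X -> posdef Y -> loewner X Y -> loewner (mfun f X) (mfun f Y).

(* Only the values of f on (0, +oo) matter. *)
Record representing_function (R : realType) (D : scalars R) n
    (sigma : 'M[D]_n -> 'M[D]_n -> 'M[D]_n) (f : R -> R) : Prop :=
  RepresentingFunction {
    repr_gt0 : forall t, 0 < t -> 0 < f t;
    repr_continuous : {in `]0, +oo[, continuous f};
    repr_monotone : operator_monotone f;
    repr_1 : f 1 = 1;
    repr_mean : forall A B, posdef A -> posdef B ->
      sigma A B = msqrt A *m mfun f (misqrt A *m B *m misqrt A) *m msqrt A }.

Definition affine_on_pos (R : realType) (f : R -> R) : Prop :=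
  exists a b : R, forall t, 0 < t -> f t = a * t + b.

(* Main.v *)
(* Writing A = G G^* and B = G diag(l) G^* with l_i > 0, congruence invariance
   gives A sigma B = G diag(f(l)) G^*, so that A sigma B = a A + b B means that f
   agrees with t |-> a + b t on Spec(A^{-1} B) = {l_i}.  At most two points can
   always be interpolated.  For the converse, restrict sigma to matrices that are
   the identity outside a 2 x 2 block.  Monotonicity of sigma along a rank one
   perturbation of the block, explicitly diagonalized by a Cauchy matrix, yields
   Loewner's inequality
     f[p,s] f[q,r] <= f[p,q] f[r,s]   for divided differences, p < q < r < s.
   Together with monotonicity it implies that f is concave (let s tend to
   infinity), and that f is affine on [p, +oo) as soon as it agrees with an
   affine function at three points p < q < r.  The same holds for the transpose
   t f(1/t), by monotonicity of sigma in its first argument, hence f is affine on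
   (0, +oo).  The spectral theorem is proved uniformly over R, C and H, with an
   eigenvector obtained from the action of the matrix on real coordinates and
   deflation by Householder reflections. *)
From HB Require Import structures.
Require Import Defs.
From mathcomp Require Import all_boot all_order all_algebra.
From mathcomp Require Import complex ring lra.
From mathcomp Require Import all_classical all_reals all_analysis.
Set Implicit Arguments.
Unset Strict Implicit.
Unset Printing Implicit Defensive.
Import Order.TTheory GRing.Theory Num.Theory.
Local Open Scope classical_set_scope.
Local Open Scope card_scope.
Local Open Scope ring_scope.

(** * Functions satisfying Loewner's four point inequality *)

Section FourPoint.
Variables (R : realFieldType) (g : R -> R).

Definition nondecreasing_on_pos := forall s t, 0 < s -> s <= t -> g s <= g t.

(** Loewner's inequality between divided differences, with the positive denominators multiplied out
    so that no division occurs. *)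
Definition four_point := forall p q r s,
  0 < p -> p < q -> q < r -> r < s ->
  (g s - g p) * (g r - g q) * ((q - p) * (s - r))
    <= (g q - g p) * (g s - g r) * ((s - p) * (r - q)).

Hypotheses (g_mono : nondecreasing_on_pos) (g_four : four_point).

(* Let s tend to infinity in four_point. *)
Lemma four_point_concave p q r : 0 < p -> p < q -> q < r ->
  (g r - g q) * (q - p) <= (g q - g p) * (r - q).
Proof.
move=> p0 pq qr; rewrite leNgt; apply/negP.
set al := (X in _ < X); set be := (X in X < _) => beal.
have q0 : 0 < q by lra.
have r0 : 0 < r by lra.
have be0 : 0 <= be.
  by apply: mulr_ge0; rewrite subr_ge0 ?(ltW qr)// g_mono// ltW.
have gqr : g q < g r.
  have : 0 < al by lra.
  by rewrite /al pmulr_lgt0 subr_gt0.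
have gpq : g p <= g q by rewrite g_mono// ltW.
have d0 : 0 < al - be by rewrite subr_gt0.
have e0 : 0 <= be * (r - p) / (al - be).
  by apply: divr_ge0; [apply: mulr_ge0 => //; lra | exact: ltW].
(* With this [s] the product [(al - be) * (s - r)] exceeds [be * (r - p)] by exactly [al - be > 0],
   whereas the four point inequality, once [g s - g r] is bounded by [g s - g p], gives the opposite
   comparison. *)
pose s := r + 1 + be * (r - p) / (al - be).
have rs : r < s by rewrite /s; lra.
have grs : g r <= g s by rewrite g_mono// ltW.
have sp : 0 < s - p by lra.
have gsp : 0 < g s - g p by lra.
have := g_four p0 pq qr rs.
have -> : (g s - g p) * (g r - g q) * ((q - p) * (s - r))
    = (g s - g p) * (al * (s - r)).
  by rewrite /al; ring.
have -> : (g q - g p) * (g s - g r) * ((s - p) * (r - q))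
    = (g s - g r) * (be * (s - p)).
  by rewrite /be; ring.
have : (g s - g r) * (be * (s - p)) <= (g s - g p) * (be * (s - p)).
  by apply: ler_wpM2r; [apply: mulr_ge0; rewrite // ltW | lra].
move=> h1 h2; have := le_trans h2 h1; rewrite ler_pM2l// => h3.
have h4 : (al - be) * (s - r) <= be * (r - p) by lra.
have h5 : (al - be) * (s - r) = (al - be) + be * (r - p).
  by rewrite /s; field; rewrite gt_eqF.
by lra.
Qed.

(** Between [p] and [r] concavity alone squeezes [g] onto the line. Beyond [r] concavity gives only
    the upper bound; the lower bound comes from the four point inequality when the slope [a] is
    positive, and from monotonicity when [a = 0]. *)
Lemma four_point_affine a b p q r : 0 < p -> p < q -> q < r ->
  g p = a * p + b -> g q = a * q + b -> g r = a * r + b ->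
  forall t, p <= t -> g t = a * t + b.
Proof.
move=> p0 pq qr gp gq gr t; have q0 : 0 < q by lra.
rewrite le_eqVlt => /predU1P[<-//|pt].
have t0 : 0 < t by lra.
have [tq|qt|->//] := ltgtP t q.
  have := four_point_concave p0 pt tq.
  have := four_point_concave t0 tq qr.
  by rewrite gp gq gr; set G := g t; nra.
have [tr|rt|->//] := ltgtP t r.
  have := four_point_concave p0 pq qt.
  have := four_point_concave q0 qt tr.
  by rewrite gp gq gr; set G := g t; nra.
have := four_point_concave q0 qr rt.
have := g_four p0 pq qr rt.
have : g p <= g q by rewrite g_mono// ltW.
have : g r <= g t by rewrite g_mono ?ltW//; lra.
rewrite gp gq gr; set h := g t - (a * t + b).
have -> : g t = h + a * t + b by rewrite /h; ring.
move=> h1 h2 h3 h4; suff : h = 0 by move=> ->; rewrite add0r.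
apply/eqP; rewrite eq_le; apply/andP; split.
  have : h * (r - q) <= 0 by lra.
  by rewrite pmulr_lle0 // subr_gt0.
have a0 : 0 <= a.
  have : 0 <= a * (q - p) by lra.
  by rewrite pmulr_lge0 // subr_gt0.
move: a0; rewrite [0 <= a]le_eqVlt => /predU1P[a0|a0].
  by move: h1; rewrite -a0; lra.
have : 0 <= h * (a * (r - q) * (q - p) * (r - p)) by lra.
by rewrite pmulr_lge0 // !mulr_gt0 // subr_gt0 //; lra.
Qed.

End FourPoint.

(** The function itself settles [t >= p]. Transposition swaps slope and intercept and turns
    [p < q < r] into [r^-1 < q^-1 < p^-1], so the same result on [[r^-1, +oo)] settles
    [0 < t <= r]. *)
Lemma affine_of_transpose (R : realFieldType) (f : R -> R) a b p q r :
  nondecreasing_on_pos f -> four_point f ->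
  nondecreasing_on_pos (fun t => t * f t^-1) ->
  four_point (fun t => t * f t^-1) ->
  0 < p -> p < q -> q < r ->
  f p = a * p + b -> f q = a * q + b -> f r = a * r + b ->
  forall t, 0 < t -> f t = a * t + b.
Proof.
move=> fm ff tm tf p0 pq qr fp fq fr t t0.
have [pt|tp] := leP p t; first exact: (four_point_affine fm ff p0 pq qr).
have [q0 r0] : 0 < q /\ 0 < r by split; lra.
have transposeE s : 0 < s -> f s = a * s + b -> s^-1 * f s^-1^-1 = b * s^-1 + a.
  by move=> s0 fs; rewrite invrK fs; field; rewrite gt_eqF.
have tr : t <= r by lra.
have h : t^-1 * f t^-1^-1 = b * t^-1 + a.
  apply: (four_point_affine tm tf (p := r^-1) (q := q^-1) (r := p^-1));
    rewrite ?transposeE ?invr_gt0 ?ltf_pV2 ?posrE ?lef_pV2 ?posrE//.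
rewrite invrK in h.
have -> : f t = t * (t^-1 * f t) by rewrite mulVKf// gt_eqF.
by rewrite h; field; rewrite gt_eqF.
Qed.

(** * Binary quadratic forms and the four point inequality *)

Lemma psd2_discriminant (R : realFieldType) (a b c : R) :
  (forall u v, 0 <= a * u ^+ 2 + 2 * b * (u * v) + c * v ^+ 2) -> b ^+ 2 <= a * c.
Proof.
move=> psd; have c0 : 0 <= c by have := psd 0 1; lra.
move: c0; rewrite le_eqVlt => /predU1P[c0|c0].
  (* For [c = 0] the form takes the value [- b ^+ 2] at this vector. *)
  have := psd b (- (a + 1) / 2).
  rewrite -c0 => h; have : - b ^+ 2 >= 0 by nra.
  by lra.
have : 0 <= c * (a * c - b ^+ 2) by have := psd c (- b); lra.
by rewrite pmulr_rge0// subr_ge0.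
Qed.

(** [P], [Q], [T], [W] stand for the values of a function at [p], [q], [r], [s]. The difference of
    the two sides is a quadratic form in [u] and [v] whose determinant is a positive multiple of the
    four point gap. *)
Lemma four_point_of_psd (R : realFieldType) (p q r s P Q T W : R) :
  p < q -> q < r -> r < s ->
  (forall u v,
    (r - p) / ((q - p) * (s - p)) * P * u ^+ 2 + (r - p) / ((r - q) * (s - r)) * T * v ^+ 2
    <= (q - p) * (r - q) / (s - q) * Q * (u / (q - p) + v / (q - r)) ^+ 2
     + (s - p) * (s - r) / (s - q) * W * (u / (s - p) + v / (s - r)) ^+ 2) ->
  (W - P) * (T - Q) * ((q - p) * (s - r)) <= (Q - P) * (W - T) * ((s - p) * (r - q)).
Proof.
move=> pq qr rs psd.
have [qp0 rq0 sr0] : [/\ q - p != 0, r - q != 0 & s - r != 0].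
  by rewrite !subr_eq0 !gt_eqF.
have [pr ps qs] : [/\ p < r, p < s & q < s] by split; lra.
have [rp0 sp0 sq0] : [/\ r - p != 0, s - p != 0 & s - q != 0].
  by rewrite !subr_eq0 !gt_eqF.
have qr0 : q - r != 0 by rewrite subr_eq0 lt_eqF.
pose a := Q * (r - q) / ((q - p) * (s - q)) + W * (s - r) / ((s - p) * (s - q))
          - P * (r - p) / ((q - p) * (s - p)).
pose b := (W - Q) / (s - q).
pose c := Q * (q - p) / ((r - q) * (s - q)) + W * (s - p) / ((s - r) * (s - q))
          - T * (r - p) / ((r - q) * (s - r)).
have : b ^+ 2 <= a * c.
  apply: psd2_discriminant => u v; have := psd u v; rewrite -subr_ge0.
  by congr (0 <= _); rewrite /a /b /c; field; rewrite qp0 rq0 sr0 sp0 sq0 qr0.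
have -> : a * c = b ^+ 2 + (r - p) / ((s - q) * (q - p) * (s - p) * (r - q) * (s - r)) *
  ((Q - P) * (W - T) * ((s - p) * (r - q)) - (W - P) * (T - Q) * ((q - p) * (s - r))).
  by rewrite /a /b /c; field; rewrite qp0 rq0 sr0 sp0 sq0.
rewrite lerDl pmulr_rge0 ?subr_ge0//.
by rewrite divr_gt0 ?mulr_gt0// subr_gt0.
Qed.

(** * The scalars *)

(** The common laws through which R, C and H are treated uniformly: [normsq] provides cancellation
    in place of inverses, and [coords] turns matrices over [D] into real ones. *)
Record star_division_algebra (R : realType) (D : scalars R) := StarDivisionAlgebra {
  sconjD : forall x y : D, sconj (x + y) = sconj x + sconj y;
  sconjM : forall x y : D, sconj (x * y) = sconj y * sconj x;
  sconjK : involutive (@sconj R D);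
  sconj_real : forall a, sconj (of_real D a) = of_real D a;
  of_realD : forall a b, of_real D (a + b) = of_real D a + of_real D b;
  of_realM : forall a b, of_real D (a * b) = of_real D a * of_real D b;
  of_real1 : of_real D 1 = 1;
  of_realC : forall a (x : D), of_real D a * x = x * of_real D a;
  normsq : D -> R;
  normsqE : forall x : D, sconj x * x = of_real D (normsq x);
  normsq_ge0 : forall x, 0 <= normsq x;
  normsq_eq0 : forall x, normsq x = 0 -> x = 0;
  rdim : nat;
  coords : D -> 'rV[R]_rdim;
  of_coords : 'rV[R]_rdim -> D;
  coordsK : cancel coords of_coords;
  of_coordsK : cancel of_coords coords;
  coordsZD : forall a x y, coords (of_real D a * x + y) = a *: coords x + coords y }.

Arguments of_coords {R D} s _.

Section Instances.
Variable R : realType.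

Lemma real_star_division_algebra : star_division_algebra (scalars_of R Reals).
Proof.
apply: (@StarDivisionAlgebra R (scalars_of R Reals) _ _ _ _ _ _ _ _
  (fun x => x ^+ 2) _ _ _ 1 (fun x => const_mx x) (fun v => v 0 0)) => //=.
- by move=> x y; rewrite mulrC.
- by move=> a x; rewrite mulrC.
- by move=> x; rewrite sqr_ge0.
- by move=> x /eqP; rewrite sqrf_eq0 => /eqP.
- by move=> x; rewrite mxE.
- by move=> v; apply/rowP => i; rewrite mxE ord1.
- by move=> a x y; apply/rowP => i; rewrite !mxE.
Qed.

Lemma complex_star_division_algebra : star_division_algebra (scalars_of R Complexes).
Proof.
apply: (@StarDivisionAlgebra R (scalars_of R Complexes) _ _ _ _ _ _ _ _
  (fun x : R[i] => complex.Re x ^+ 2 + complex.Im x ^+ 2) _ _ _ 2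
  (fun x : R[i] => \row_j nth 0 [:: complex.Re x; complex.Im x] j)
  (fun v : 'rV[R]_2 => Complex (v 0 0) (v 0 1))) => /=.
- by move=> [a b] [c d]; congr Complex => /=; ring.
- by move=> [a b] [c d]; congr Complex => /=; ring.
- by move=> [a b]; congr Complex => /=; ring.
- by move=> a; congr Complex => /=; ring.
- by move=> a b; congr Complex => /=; ring.
- by move=> a b; congr Complex => /=; ring.
- by [].
- by move=> a [c d]; congr Complex => /=; ring.
- by move=> [a b]; congr Complex => /=; ring.
- by move=> [a b] /=; rewrite addr_ge0 ?sqr_ge0.
- move=> [a b] /= /eqP; rewrite paddr_eq0 ?sqr_ge0// !sqrf_eq0.
  by move=> /andP[/eqP -> /eqP ->].
- by move=> [a b]; rewrite !mxE.
- by move=> v; apply/rowP => -[[|[|//]] i]; rewrite mxE /=; congr (v _ _); apply: val_inj.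
- move=> a [b c] [d e]; apply/rowP => -[[|[|//]] i]; rewrite !mxE /=; ring.
Qed.

Lemma quat_star_division_algebra : star_division_algebra (scalars_of R Quaternions).
Proof.
apply: (@StarDivisionAlgebra R (scalars_of R Quaternions) _ _ _ _ _ _ _ _
  (fun x : quat R => qre x ^+ 2 + qi x ^+ 2 + qj x ^+ 2 + qk x ^+ 2) _ _ _ 4
  (fun x : quat R => \row_j nth 0 [:: qre x; qi x; qj x; qk x] j)
  (fun v : 'rV[R]_4 => Quat (v 0 0) (v 0 1) (v 0 (inord 2)) (v 0 (inord 3)))) => /=.
- by move=> [a b c d] [a' b' c' d']; congr Quat => /=; ring.
- by move=> [a b c d] [a' b' c' d']; congr Quat => /=; ring.
- by move=> [a b c d]; congr Quat => /=; ring.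
- by move=> a; congr Quat => /=; ring.
- by move=> a b; congr Quat => /=; ring.
- by move=> a b; congr Quat => /=; ring.
- by [].
- by move=> a [b c d e]; congr Quat => /=; ring.
- by move=> [a b c d]; congr Quat => /=; ring.
- by move=> [a b c d] /=; rewrite !addr_ge0 ?sqr_ge0.
- move=> [a b c d] /= /eqP; rewrite !paddr_eq0 ?addr_ge0 ?sqr_ge0// !sqrf_eq0.
  by move=> /andP[/andP[/andP[/eqP -> /eqP ->] /eqP ->] /eqP ->].
- by move=> [a b c d]; rewrite !mxE /= !inordK.
- move=> v; apply/rowP => -[[|[|[|[|//]]]] i]; rewrite mxE /=; congr (v _ _);
    by apply: val_inj; rewrite /= ?inordK.
- move=> a [b c d e] [b' c' d' e'].
  by apply/rowP => -[[|[|[|[|//]]]] i]; rewrite !mxE /=; ring.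
Qed.

Lemma scalars_star_division_algebra k : star_division_algebra (scalars_of R k).
Proof.
case: k; [exact: real_star_division_algebra|exact: complex_star_division_algebra|].
exact: quat_star_division_algebra.
Qed.

End Instances.

(** * Conjugate transposes and norms of column vectors *)

Section StarMatrices.
Variables (R : realType) (D : scalars R) (S : star_division_algebra D).

Lemma of_real_is_zmod_morphism : zmod_morphism (of_real D).
Proof.
by move=> a b; apply: (addIr (of_real D b)); rewrite -(of_realD S) !subrK.
Qed.
HB.instance Definition _ :=
  GRing.isZmodMorphism.Build R D (of_real D) of_real_is_zmod_morphism.
HB.instance Definition _ :=
  GRing.isMonoidMorphism.Build R D (of_real D) (of_real1 S, of_realM S).

Lemma sconj_is_zmod_morphism : zmod_morphism (@sconj R D).
Proof.
by move=> x y; apply: (addIr (sconj y)); rewrite -(sconjD S) !subrK.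
Qed.
HB.instance Definition _ :=
  GRing.isZmodMorphism.Build D D (@sconj R D) sconj_is_zmod_morphism.

Lemma of_real_unit_mulI a : a != 0 -> injective ( *%R (of_real D a)).
Proof.
move=> a0 x y /(congr1 ( *%R (of_real D a^-1))).
by rewrite !mulrA -rmorphM mulVf// rmorph1 !mul1r.
Qed.

Lemma of_real_inj : injective (of_real D).
Proof.
move=> a b /eqP; rewrite -subr_eq0 -rmorphB => /eqP ab0.
apply/eqP; rewrite -subr_eq0; apply/negP => /negP ab.
have ab10 : of_real D (a - b) * 1 = of_real D (a - b) * 0 by rewrite ab0 !mul0r.
by have /eqP := of_real_unit_mulI ab ab10; rewrite oner_eq0.
Qed.

Lemma normsq_conj (x : D) : x * sconj x = of_real D (normsq S (sconj x)).
Proof. by rewrite -(normsqE S) (sconjK S). Qed.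

(** Multiplying on the left by the conjugate of [x] replaces [x] by a nonzero real, which can be
    cancelled. *)
Lemma mul_normsq_eq0 (x y : D) : x * y = 0 -> x != 0 -> y = 0.
Proof.
move=> xy x0; apply: (@of_real_unit_mulI (normsq S x)).
  by apply: contra x0 => /eqP /(normsq_eq0 (s:=S)) ->.
by rewrite -(normsqE S) -mulrA xy !mulr0.
Qed.

Local Notation "A ^H" := (ctransmx A) (format "A ^H").
Local Notation "M %:D" := (map_mx (of_real D) M) (format "M %:D").

Lemma ctransmxE m n (A : 'M[D]_(m, n)) i j : A^H i j = sconj (A j i).
Proof. by rewrite !mxE. Qed.

Lemma ctransmxK m n (A : 'M[D]_(m, n)) : A^H^H = A.
Proof. by apply/matrixP => i j; rewrite !ctransmxE (sconjK S). Qed.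

Lemma ctransmxM m n p (A : 'M[D]_(m, n)) (B : 'M[D]_(n, p)) : (A *m B)^H = B^H *m A^H.
Proof.
apply/matrixP => i j; rewrite ctransmxE !mxE raddf_sum.
by apply: eq_bigr => k _; rewrite /= (sconjM S) !ctransmxE.
Qed.

Lemma ctransmxD m n (A B : 'M[D]_(m, n)) : (A + B)^H = A^H + B^H.
Proof. by rewrite /ctransmx map_mxD linearD. Qed.

Lemma ctransmxB m n (A B : 'M[D]_(m, n)) : (A - B)^H = A^H - B^H.
Proof. by rewrite /ctransmx map_mxB linearB. Qed.

Lemma ctransmx0 m n : (0 : 'M[D]_(m, n))^H = 0.
Proof. by rewrite /ctransmx map_mx0 trmx0. Qed.

Lemma ctransmx_real m n (M : 'M[R]_(m, n)) : (M%:D)^H = (M^T)%:D.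
Proof. by apply/matrixP => i j; rewrite !mxE (sconj_real S). Qed.

Lemma ctransmx1 n : (1%:M : 'M[D]_n)^H = 1%:M.
Proof. by rewrite -(map_mx1 (of_real D)) ctransmx_real trmx1. Qed.

Lemma ctransmxZ m n a (A : 'M[D]_(m, n)) : (of_real D a *: A)^H = of_real D a *: A^H.
Proof.
apply/matrixP => i j.
by rewrite !mxE (sconjM S) (sconj_real S) (of_realC S).
Qed.

Lemma scalemx_realAr m n p a (A : 'M[D]_(m, n)) (B : 'M[D]_(n, p)) :
  A *m (of_real D a *: B) = of_real D a *: (A *m B).
Proof.
apply/matrixP => i j; rewrite !mxE mulr_sumr; apply: eq_bigr => k _.
by rewrite !mxE !mulrA (of_realC S).
Qed.

Lemma mulmx_real_scalar m n a (A : 'M[D]_(m, n)) :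
  A *m (of_real D a)%:M = of_real D a *: A.
Proof. by rewrite -scalemx1 scalemx_realAr mulmx1. Qed.

Lemma real_diagE n (l : 'rV[R]_n) : real_diag D l = (diag_mx l)%:D.
Proof. by rewrite /real_diag map_diag_mx. Qed.

Lemma ctransmx_diag n (l : 'rV[R]_n) : (real_diag D l)^H = real_diag D l.
Proof. by rewrite real_diagE ctransmx_real tr_diag_mx. Qed.

Definition colnormsq n (v : 'cV[D]_n) : R := \sum_i normsq S (v i 0).

Lemma colnormsqE n (v : 'cV[D]_n) : v^H *m v = (of_real D (colnormsq v))%:M.
Proof.
apply/matrixP => i j; rewrite !ord1 !mxE eqxx mulr1n rmorph_sum.
by apply: eq_bigr => k _; rewrite ctransmxE (normsqE S).
Qed.

Lemma colnormsq_ge0 n (v : 'cV[D]_n) : 0 <= colnormsq v.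
Proof. by apply: sumr_ge0 => i _; exact: normsq_ge0. Qed.

Lemma colnormsq_eq0 n (v : 'cV[D]_n) : colnormsq v = 0 -> v = 0.
Proof.
move/eqP; rewrite psumr_eq0; last by move=> i _; exact: normsq_ge0.
move=> /allP v0; apply/matrixP => i j; rewrite ord1 mxE.
by apply: (normsq_eq0 (s:=S)); apply/eqP; apply: v0; rewrite mem_index_enum.
Qed.

Lemma colnormsq_gt0 n (v : 'cV[D]_n) : v != 0 -> 0 < colnormsq v.
Proof.
move=> v0; rewrite lt_neqAle colnormsq_ge0 andbT eq_sym.
by apply: contra v0 => /eqP/colnormsq_eq0 ->.
Qed.

(** * Spectral theorem *)

(* Reflection in w = v - e.  It sends v to e only because e^H v is real. *)
Lemma householder n (v e : 'cV[D]_n) t :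
  v^H *m v = 1%:M -> e^H *m e = 1%:M -> e^H *m v = (of_real D t)%:M ->
  exists H : 'M[D]_n, [/\ H^H = H, H *m H = 1%:M & H *m v = e].
Proof.
move=> vv ee ev.
have ve : v^H *m e = (of_real D t)%:M.
  rewrite -[e]ctransmxK -ctransmxM ev -map_scalar_mx ctransmx_real.
  by rewrite tr_scalar_mx map_scalar_mx.
pose w := v - e; pose s := 2 - 2 * t.
have ww : w^H *m w = (of_real D s)%:M.
  rewrite /w ctransmxB mulmxBl !mulmxBr vv ee ev ve.
  rewrite -!(raddfB (@scalar_mx D 1)) -(rmorph1 (of_real D)) -!rmorphB.
  by congr (of_real D _)%:M; rewrite /s; ring.
have wv : w^H *m v = (of_real D (1 - t))%:M.
  rewrite /w ctransmxB mulmxBl vv ev -(raddfB (@scalar_mx D 1)).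
  by rewrite -(rmorph1 (of_real D)) -rmorphB.
(* Here [s] is the squared norm of [w]; if it vanishes then [v = e] and the identity serves as the
   reflection. *)
have [s0|s0] := eqVneq s 0.
  exists 1%:M; rewrite ctransmx1 !mul1mx; split=> //.
  apply/eqP; rewrite -subr_eq0 -/w; apply/eqP/colnormsq_eq0/of_real_inj.
  move: ww; rewrite colnormsqE s0 => /matrixP/(_ 0 0).
  by rewrite !mxE eqxx !mulr1n.
(* This identity makes the reflection with coefficient [2 / s] subtract exactly [w] from [v]. *)
have tE : 1 - t = s / 2 by rewrite /s; field.
pose c := 2 / s.
exists (1%:M - of_real D c *: (w *m w^H)); split.
- by rewrite ctransmxB ctransmx1 ctransmxZ ctransmxM ctransmxK.
- set P := w *m w^H; have PP : P *m P = of_real D s *: P.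
    by rewrite /P -mulmxA (mulmxA w^H) ww mulmxA mulmx_real_scalar -scalemxAl.
  rewrite mulmxBl mul1mx mulmxBr mulmx1 -scalemxAl scalemx_realAr PP !scalerA -rmorphM.
  rewrite -rmorphM (_ : c * _ = c + c); last by rewrite /c; field.
  by rewrite rmorphD scalerDl opprB addrK subrK.
- rewrite mulmxBl mul1mx -scalemxAl -mulmxA wv mulmx_real_scalar scalerA -rmorphM.
  have -> : c * (1 - t) = 1 by rewrite tE /c; field.
  by rewrite rmorph1 scale1r /w opprB addrC subrK.
Qed.

(** * Realification of vectors and matrices *)

Let of_coordsD u v : of_coords S (u + v) = of_coords S u + of_coords S v.
Proof.
apply: (can_inj (coordsK S)); rewrite of_coordsK.
have := coordsZD S 1 (of_coords S u) (of_coords S v).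
by rewrite rmorph1 mul1r scale1r !of_coordsK => ->.
Qed.

Let coords0 : coords S 0 = 0.
Proof.
by have := coordsZD S (-1) 0 0; rewrite mulr0 addr0 scaleN1r addNr.
Qed.

Let coordsZ a x : coords S (of_real D a * x) = a *: coords S x.
Proof. by have := coordsZD S a x 0; rewrite !addr0 coords0 addr0. Qed.

Let of_coordsZ a u : of_coords S (a *: u) = of_real D a * of_coords S u.
Proof. by apply: (can_inj (coordsK S)); rewrite of_coordsK coordsZ of_coordsK. Qed.

(** Columns over [D] become real rows, so left multiplication by a matrix over [D] becomes right
    multiplication by a real matrix. *)
Definition realify n (x : 'cV[D]_n) : 'rV[R]_(n * rdim S) :=
  mxvec (\matrix_(i, j) coords S (x i 0) 0 j).
Definition unrealify n (u : 'rV[R]_(n * rdim S)) : 'cV[D]_n :=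
  \col_i of_coords S (row i (vec_mx u)).

Lemma realifyK n : cancel (@realify n) (@unrealify n).
Proof.
move=> x; apply/matrixP => i j; rewrite ord1 mxE mxvecK.
rewrite -[RHS](coordsK S); congr of_coords.
by apply/rowP => k; rewrite !mxE.
Qed.

Lemma unrealifyK n : cancel (@unrealify n) (@realify n).
Proof.
move=> u; rewrite -[RHS]vec_mxK; congr mxvec.
by apply/matrixP => i j; rewrite mxE mxE of_coordsK mxE.
Qed.

Lemma unrealifyD n (u v : 'rV_(n * rdim S)) :
  unrealify (u + v) = unrealify u + unrealify v.
Proof. by apply/matrixP => i j; rewrite !mxE !linearD/= -of_coordsD. Qed.

Lemma unrealifyZ n a (u : 'rV_(n * rdim S)) :
  unrealify (a *: u) = of_real D a *: unrealify u.
Proof. by apply/matrixP => i j; rewrite !mxE !linearZ/= of_coordsZ. Qed.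

Definition real_action n (A : 'M[D]_n) u := realify (A *m unrealify u).

Lemma real_action_is_linear n (A : 'M[D]_n) : linear (real_action A).
Proof.
rewrite /real_action.
move=> a u v; apply: (can_inj (@unrealifyK n)).
by rewrite !(unrealifyD, unrealifyZ, realifyK) mulmxDr scalemx_realAr.
Qed.
HB.instance Definition _ n (A : 'M[D]_n) := GRing.isLinear.Build R _ _ _
  (real_action A) (real_action_is_linear A).

Definition real_mx n (A : 'M[D]_n) : 'M[R]_(n * rdim S) :=
  lin1_mx (real_action A).

Lemma mul_real_mx n (A : 'M[D]_n) u : u *m real_mx A = realify (A *m unrealify u).
Proof. by rewrite mul_rV_lin1. Qed.

(* mulmx1C needs commutative scalars, hence the detour through real matrices. *)
Lemma mulmx1C_star n (A B : 'M[D]_n) : A *m B = 1%:M -> B *m A = 1%:M.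
Proof.
move=> AB.
(* Realification reverses products, so this is the image of [A *m B]. *)
have : real_mx B *m real_mx A = 1%:M.
  apply/row_matrixP => i.
  by rewrite row_mul !rowE mulmx1 !mul_real_mx realifyK mulmxA AB mul1mx unrealifyK.
move=> /mulmx1C BA; apply/matrixP => i j.
(* Acting on a basis column reads off column [j] of [B *m A]. *)
have := congr1 (mulmx (realify (delta_mx j 0))) BA.
rewrite mulmxA !mul_real_mx mulmx1 => /(can_inj (@realifyK n)).
rewrite !realifyK mulmxA => /matrixP/(_ i 0).
by rewrite -colE mxE => ->; rewrite !mxE eqxx andbT.
Qed.

Lemma rdim_gt0 : (0 < rdim S)%N.
Proof.
rewrite lt0n; apply/eqP => d0.
have : coords S 1 = coords S 0.
  by apply/rowP => -[i i0]; exfalso; move: i0; rewrite d0.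
by move/(can_inj (coordsK S)) => /eqP; rewrite oner_eq0.
Qed.

(* A complex eigenvalue lambda + i mu of the realified matrix gives
   A x = x lambda - y mu and A y = x mu + y lambda; symmetry of A then forces
   mu (|x|^2 + |y|^2) = 0. *)
Lemma hermitian_eigenvector n (A : 'M[D]_n.+1) : Defs.hermitian A ->
  exists lambda, exists2 v : 'cV[D]_n.+1, v != 0 & A *m v = of_real D lambda *: v.
Proof.
move=> hA; pose T := map_mx (real_complex R) (real_mx A).
have [|[lambda mu] /eigenvalueP[w wT w0]] := eigenvalue_closed T.
  by rewrite muln_gt0 rdim_gt0.
pose u := map_mx (@complex.Re R) w; pose v := map_mx (@complex.Im R) w.
pose x := unrealify u; pose y := unrealify v.
have uT : u *m real_mx A = lambda *: u - mu *: v.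
  apply/rowP => j; have /rowP/(_ j) := wT; rewrite !mxE => /(congr1 (@complex.Re R)).
  have ReD : {morph @complex.Re R : a b / a + b} by move=> [? ?] [].
  rewrite (big_morph _ ReD (erefl _)) => wTj.
  apply: etrans (etrans wTj _).
    by apply: eq_bigr => k _; rewrite !mxE; case: (w 0 k) => a b /=; ring.
  by case: (w 0 j).
have vT : v *m real_mx A = mu *: u + lambda *: v.
  apply/rowP => j; have /rowP/(_ j) := wT; rewrite !mxE => /(congr1 (@complex.Im R)).
  have ImD : {morph @complex.Im R : a b / a + b} by move=> [? ?] [].
  rewrite (big_morph _ ImD (erefl _)) => wTj.
  apply: etrans (etrans wTj _).
    by apply: eq_bigr => k _; rewrite !mxE; case: (w 0 k) => a b /=; ring.
  by case: (w 0 j) => a b /=; ring.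
have Ax : A *m x = of_real D lambda *: x - of_real D mu *: y.
  transitivity (unrealify (lambda *: u - mu *: v)).
    by rewrite -uT mul_real_mx realifyK.
  by rewrite -scaleNr unrealifyD !unrealifyZ rmorphN scaleNr.
have Ay : A *m y = of_real D mu *: x + of_real D lambda *: y.
  transitivity (unrealify (mu *: u + lambda *: v)).
    by rewrite -vT mul_real_mx realifyK.
  by rewrite unrealifyD !unrealifyZ.
have unrealify_neq0 z : z != 0 -> unrealify z != 0 :> 'cV[D]_n.+1.
  apply: contra => /eqP z0; apply/eqP/(can_inj (@unrealifyK _)).
  by have := @unrealifyZ n.+1 0 0; rewrite z0 scaler0 rmorph0 scale0r.
have uv0 : (u != 0) || (v != 0).
  rewrite -negb_and; apply: contra w0 => /andP[/eqP/rowP u0 /eqP/rowP v0].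
  apply/eqP/rowP => j; move: (u0 j) (v0 j); rewrite !mxE.
  by case: (w 0 j) => a b /= -> ->.
have mu0 : mu = 0.
  (* After expansion the [lambda] terms cancel and [mu] times the squared norm of [x] equals minus
     [mu] times that of [y]. *)
  have : (A *m y)^H *m x = y^H *m (A *m x) by rewrite ctransmxM hA mulmxA.
  rewrite Ax Ay ctransmxD !ctransmxZ mulmxDl mulmxBr -!scalemxAl !scalemx_realAr.
  rewrite [LHS]addrC => /addrI/eqP; rewrite -subr_eq0 opprK !colnormsqE.
  rewrite -!mul_scalar_mx -!scalar_mxM -raddfD/= -!rmorphM -rmorphD/=.
  move=> /eqP/matrixP/(_ 0 0); rewrite !mxE eqxx mulr1n -(rmorph0 (of_real D)).
  move=> /of_real_inj/eqP; rewrite -mulrDr mulf_eq0 => /orP[/eqP//|].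
  rewrite paddr_eq0 ?colnormsq_ge0// => /andP[/eqP/colnormsq_eq0 x0 /eqP/colnormsq_eq0 y0].
  by case/orP: uv0 => /unrealify_neq0; rewrite -/x -/y ?x0 ?y0 eqxx.
rewrite mu0 rmorph0 !scale0r ?subr0 ?add0r in Ax Ay.
by exists lambda; case/orP: uv0 => /unrealify_neq0 ?; [exists x|exists y].
Qed.

(** For [z != 0] take the conjugate of [z] divided by its norm. This is what makes an eigenvector
    meet the reality condition of [householder]. *)
Lemma real_phase (z : D) : exists2 q : D, sconj q * q = 1 & exists t, z * q = of_real D t.
Proof.
have [->|z0] := eqVneq z 0.
  exists 1; first by rewrite mulr1 -(rmorph1 (of_real D)) (sconj_real S).
  by exists 0; rewrite mul0r rmorph0.
pose s := normsq S (sconj z).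
have s0 : 0 < s.
  rewrite lt_neqAle (normsq_ge0 S) andbT eq_sym; apply: contra z0 => /eqP.
  by move=> /(normsq_eq0 (s:=S)) /(congr1 (@sconj R D)); rewrite (sconjK S) raddf0 => ->.
exists (sconj z * of_real D (Num.sqrt s)^-1).
  rewrite (sconjM S) (sconjK S) (sconj_real S) mulrA -(mulrA _ z) normsq_conj -/s.
  rewrite -!rmorphM -(rmorph1 (of_real D)); congr (of_real D _).
  by rewrite -{2}(sqr_sqrtr (ltW s0)); field; rewrite gt_eqF// sqrtr_gt0.
exists (s * (Num.sqrt s)^-1).
by rewrite mulrA normsq_conj -rmorphM.
Qed.

(** Right multiplication by a unit phase commutes with the action of [A] and with the real
    eigenvalue, so the first coordinate can be made real before normalizing. *)
Lemma hermitian_unit_eigenvector n (A : 'M[D]_(1 + n)) : Defs.hermitian A ->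
  exists lambda t, exists v : 'cV[D]_(1 + n),
    [/\ v^H *m v = 1%:M, v 0 0 = of_real D t & A *m v = of_real D lambda *: v].
Proof.
move=> /hermitian_eigenvector[lambda [v v0 Av]].
have [q qq [t vq]] := real_phase (v 0 0).
pose s := (Num.sqrt (colnormsq v))^-1.
exists lambda, (s * t), (of_real D s *: (v *m q%:M)); split.
- rewrite ctransmxZ ctransmxM -scalemxAl scalemx_realAr -mulmxA (mulmxA v^H) colnormsqE.
  rewrite mul_scalar_mx scalemx_realAr !scalerA -!rmorphM.
  have -> : q%:M^H *m q%:M = 1%:M :> 'M[D]_1.
    by apply/matrixP => i j; rewrite !ord1 !mxE big_ord1 !mxE qq.
  rewrite (_ : _ * _ = 1) ?rmorph1 ?scale1r// /s.
  have c0 := colnormsq_gt0 v0.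
  by rewrite -{3}(sqr_sqrtr (ltW c0)); field; rewrite gt_eqF// sqrtr_gt0.
- by rewrite !mxE big_ord1 !mxE eqxx mulr1n vq rmorphM.
- by rewrite scalemx_realAr mulmxA Av -scalemxAl !scalerA -!rmorphM mulrC.
Qed.

(** A reflection sends a unit eigenvector to the first basis vector. The conjugated matrix then has
    a first column that is zero below the corner, hence by hermitian symmetry it is block diagonal,
    and induction applies to the lower block. *)
Lemma hermitian_diagonalizes n (A : 'M[D]_n) : Defs.hermitian A ->
  exists p, diagonalizes A p.
Proof.
elim: n A => [|n IHn] A hA.
  by exists (1%:M, 0); split; apply/matrixP => -[].
have [lambda [t [v [vv vt Av]]]] := @hermitian_unit_eigenvector n A hA.
pose e : 'cV[D]_(1 + n) := col_mx 1%:M 0.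
have eH : e^H = row_mx 1%:M 0.
  by rewrite /e /ctransmx map_col_mx tr_col_mx -!/(ctransmx _) ctransmx1 ctransmx0.
have [||H [HH H2 Hv]] := @householder _ v e t vv.
- by rewrite eH mul_row_col mulmx1 mulmx0 addr0.
- rewrite eH -[v]vsubmxK mul_row_col mul1mx mul0mx addr0.
  apply/matrixP => i j; rewrite !ord1 !mxE eqxx mulr1n -vt.
  by congr (v _ _); apply: val_inj.
pose A1 : 'M[D]_(1 + n) := H *m A *m H.
have hA1 : A1^H = A1 by rewrite /A1 !ctransmxM HH hA mulmxA.
have A1e : A1 *m e = of_real D lambda *: e.
  by rewrite /A1 -Hv -!mulmxA (mulmxA H H) H2 mul1mx Av scalemx_realAr.
have AE : A = H *m A1 *m H by rewrite /A1 !mulmxA H2 mul1mx -mulmxA H2 mulmx1.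
clearbody A1.
move: A1e; rewrite -[A1]submxK /e mul_block_col !mulmx1 !mulmx0 !addr0 scale_col_mx.
rewrite scaler0 => /eq_col_mx[A1ul A1dl].
move: hA1; rewrite -{1}[A1]submxK /ctransmx map_block_mx tr_block_mx -!/(ctransmx _).
rewrite -[RHS]submxK => /eq_block_mx[_ A1ur _ /IHn[[U l] []] /= UU A1dr].
have {}A1ur : ursubmx A1 = 0 by rewrite -A1ur A1dl ctransmx0.
pose W : 'M[D]_(1 + n) := block_mx 1%:M 0 0 U.
have WH : W^H = block_mx 1%:M 0 0 U^H.
  by rewrite /W /ctransmx map_block_mx tr_block_mx -!/(ctransmx _) ctransmx1 !ctransmx0.
pose l1 : 'rV[R]_(1 + n) := row_mx lambda%:M l.
have lE : real_diag D l1 =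
    block_mx (of_real D lambda *: 1%:M) 0 0 (real_diag D l) :> 'M[D]_(1 + n).
  rewrite /real_diag map_row_mx diag_mx_row; congr block_mx.
  by apply/matrixP => i j; rewrite !ord1 !mxE !eqxx !mulr1n mulr1.
have WlW : W *m (real_diag D l1 *m W^H) = A1.
  rewrite lE WH !mulmx_block !mul1mx !mul0mx !mulmx0 !mulmx1 ?mul0mx !addr0 !add0r.
  by rewrite -[RHS]submxK A1ul A1ur A1dl A1dr mulmxA mulmx0.
exists (H *m W, l1); split=> /=.
  have WW : W *m W^H = 1%:M.
    by rewrite WH mulmx_block !mul1mx !mul0mx !mulmx0 !addr0 !add0r UU -scalar_mx_block.
  by rewrite ctransmxM HH mulmxA -(mulmxA H) WW mulmx1 H2.
rewrite ctransmxM HH !mulmxA [LHS]AE; congr (_ *m _); rewrite -!mulmxA; congr (_ *m _).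
exact: (esym WlW).
Qed.

(** If [U] and [V] diagonalize [X] with spectra [l] and [m], then [W = V^H *m U] intertwines the two
    diagonals. A nonzero entry [W i j] forces [l 0 j = m 0 i], so [W] also intertwines their images
    under [f]. *)
Lemma mfun_diagonalizes n (f : R -> R) (X : 'M[D]_n) p : diagonalizes X p ->
  Defs.mfun f X = p.1 *m real_diag D (map_mx f p.2) *m p.1^H.
Proof.
case: p => U l Xp; rewrite /Defs.mfun.
have /= := xgetPex (1%:M, 0) (ex_intro (diagonalizes X) _ Xp).
case: (xget _ _) => V m /= [/= VV XV]; case: Xp => /= UU XU.
have VV' := mulmx1C_star VV; have UU' := mulmx1C_star UU.
pose W := V^H *m U.
have Wlm : W *m real_diag D l = real_diag D m *m W.
  rewrite /W -mulmxA -[real_diag D l]mulmx1 -UU' !mulmxA.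
  rewrite -2![in X in X *m U]mulmxA (mulmxA U) -XU.
  by rewrite XV !mulmxA VV' mul1mx.
have UE : U = V *m W by rewrite /W mulmxA VV mul1mx.
have WU : W *m U^H = V^H by rewrite /W -mulmxA UU mulmx1.
clearbody W.
have Wf : W *m real_diag D (map_mx f l) = real_diag D (map_mx f m) *m W.
  apply/matrixP => i j; move/matrixP/(_ i j): Wlm.
  rewrite /real_diag !mul_mx_diag !mul_diag_mx !mxE => Wij.
  have [->|W0] := eqVneq (W i j) 0; first by rewrite mulr0 mul0r.
  suff -> : l 0 j = m 0 i by rewrite (of_realC S).
  apply: of_real_inj; apply/eqP; rewrite -subr_eq0; apply/eqP.
  by apply: mul_normsq_eq0 W0; rewrite mulrBr Wij (of_realC S) subrr.
rewrite /=; have -> : U *m real_diag D (map_mx f l) = V *m real_diag D (map_mx f m) *m W.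
  by rewrite UE -!mulmxA Wf.
by rewrite -[RHS]mulmxA WU.
Qed.

(** * Real diagonal matrices, congruence and positivity *)

Definition rdiag n (g : 'I_n -> R) : 'M[D]_n := real_diag D (\row_i g i).

Lemma eq_rdiag n (g h : 'I_n -> R) : g =1 h -> rdiag g = rdiag h.
Proof. by move=> gh; congr real_diag; apply/rowP => i; rewrite !mxE gh. Qed.

Lemma real_diag_rdiag n (l : 'rV[R]_n) : real_diag D l = rdiag (l 0).
Proof. by congr real_diag; apply/rowP => i; rewrite mxE. Qed.

Lemma rdiag_map n f (g : 'I_n -> R) :
  real_diag D (map_mx f (\row_i g i)) = rdiag (fun i => f (g i)).
Proof. by congr real_diag; apply/rowP => i; rewrite !mxE. Qed.

Lemma rdiagM n (g h : 'I_n -> R) : rdiag g *m rdiag h = rdiag (fun i => g i * h i).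
Proof.
rewrite /rdiag !real_diagE -map_mxM mulmx_diag; congr (diag_mx _)%:D.
by apply/rowP => i; rewrite !mxE.
Qed.

Lemma rdiag1 n : rdiag (fun _ : 'I_n => 1) = 1%:M.
Proof.
rewrite /rdiag real_diagE -(map_mx1 (of_real D)) -diag_const_mx.
by congr (diag_mx _)%:D; apply/rowP => i; rewrite !mxE.
Qed.

Lemma ctransmx_rdiag n (g : 'I_n -> R) : (rdiag g)^H = rdiag g.
Proof. exact: ctransmx_diag. Qed.

Lemma rdiag_inverse n (g : 'I_n -> R) : (forall i, g i != 0) ->
  inverse_of (rdiag g) (rdiag (fun i => (g i)^-1)).
Proof.
move=> g0; split; rewrite rdiagM -rdiag1; apply: eq_rdiag => i.
  by rewrite divff.
by rewrite mulVf.
Qed.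

Lemma mfun_rdiag n f (g : 'I_n -> R) : Defs.mfun f (rdiag g) = rdiag (fun i => f (g i)).
Proof.
have gp : diagonalizes (rdiag g) (1%:M, \row_i g i).
  by split; rewrite /= ctransmx1 ?mul1mx ?mulmx1.
by rewrite (mfun_diagonalizes f gp) /= ctransmx1 mul1mx mulmx1 rdiag_map.
Qed.

Lemma inverse_of1 n : exists H : 'M[D]_n, inverse_of 1%:M H.
Proof. by exists 1%:M; split; rewrite mulmx1. Qed.

Lemma inverse_of_mul n (G G' H H' : 'M[D]_n) :
  inverse_of G G' -> inverse_of H H' -> inverse_of (G *m H) (H' *m G').
Proof.
move=> [G1 G2] [H1 H2]; split.
  by rewrite mulmxA -(mulmxA G) H1 mulmx1 G1.
by rewrite mulmxA -(mulmxA H') G2 mulmx1 H2.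
Qed.

Lemma inverse_of_ctransmx n (G H : 'M[D]_n) : inverse_of G H -> inverse_of G^H H^H.
Proof. by move=> [GH HG]; split; rewrite -ctransmxM ?HG ?GH ctransmx1. Qed.

Lemma qform_congr n (G A : 'M[D]_n) x : qform (G *m A *m G^H) x = qform A (G^H *m x).
Proof. by rewrite /qform ctransmxM ctransmxK !mulmxA. Qed.

Lemma posdef_congr n (G H A : 'M[D]_n) :
  inverse_of G H -> posdef A -> posdef (G *m A *m G^H).
Proof.
move=> GH [hA pA]; split.
  by rewrite /Defs.hermitian !ctransmxM ctransmxK hA mulmxA.
move=> x x0; rewrite qform_congr; apply: pA.
apply: contra x0 => /eqP Gx; have [_ HG] := inverse_of_ctransmx GH.
by rewrite -[x]mul1mx -HG -mulmxA Gx mulmx0.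
Qed.

Lemma qform_rdiag n (g : 'I_n -> R) x :
  qform (rdiag g) x = of_real D (\sum_i g i * normsq S (x i 0)).
Proof.
rewrite /qform -mulmxA mxE rmorph_sum; apply: eq_bigr => i _.
rewrite /rdiag /real_diag mul_diag_mx !mxE mulrA -(of_realC S) -mulrA (normsqE S).
by rewrite rmorphM.
Qed.

Lemma qform_rdiag_delta n (g : 'I_n -> R) i :
  qform (rdiag g) (delta_mx i 0) = of_real D (g i).
Proof.
have normsq0 : normsq S 0 = 0.
  by apply: of_real_inj; rewrite -(normsqE S) mulr0 rmorph0.
have normsq1 : normsq S 1 = 1.
  by apply: of_real_inj; rewrite -(normsqE S) mulr1 -(rmorph1 (of_real D)) (sconj_real S).
rewrite qform_rdiag (bigD1 i)//= big1 => [|j ji].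
  by rewrite mxE !eqxx addr0 normsq1 mulr1.
by rewrite mxE (negbTE ji) normsq0 mulr0.
Qed.

Lemma posdef_rdiag n (g : 'I_n -> R) : posdef (rdiag g) <-> forall i, 0 < g i.
Proof.
split=> [[_ pg] i|g0].
  have [|r r0] := pg (delta_mx i 0).
    by apply/eqP => /matrixP/(_ i 0)/eqP; rewrite !mxE !eqxx oner_eq0.
  by rewrite qform_rdiag_delta => /of_real_inj ->.
split=> [|x x0]; first exact: ctransmx_rdiag.
rewrite qform_rdiag; eexists; last by [].
have t0 i : 0 <= g i * normsq S (x i 0) by rewrite mulr_ge0 ?(normsq_ge0 S)// ltW.
rewrite lt_neqAle sumr_ge0// andbT eq_sym; apply: contra x0.
rewrite psumr_eq0// => /allP x0; apply/eqP/matrixP => i j; rewrite ord1 mxE.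
apply: (normsq_eq0 (s:=S)); apply/eqP.
by have := x0 i; rewrite mem_index_enum mulf_eq0 gt_eqF//= => ->.
Qed.

Lemma posdef1 n : posdef (1%:M : 'M[D]_n).
Proof. by rewrite -rdiag1; apply/posdef_rdiag => i; exact: ltr01. Qed.

Lemma posdef_diagonalize n (A : 'M[D]_n) : posdef A ->
  exists2 U : 'M[D]_n, inverse_of U U^H &
  exists2 g, forall i, 0 < g i & A = U *m rdiag g *m U^H.
Proof.
move=> pA; have [[U l] [/= UU Al]] := hermitian_diagonalizes (proj1 pA).
have invU : inverse_of U U^H by split=> //; exact: mulmx1C_star.
exists U => //; exists (l 0); last by rewrite -real_diag_rdiag.
apply/posdef_rdiag; rewrite -real_diag_rdiag.
have -> : real_diag D l = U^H *m A *m U^H^H.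
  rewrite ctransmxK Al; have [_ UU'] := invU.
  by rewrite !mulmxA UU' mul1mx -mulmxA UU' mulmx1.
by apply: (posdef_congr (H := U)) pA; case: invU.
Qed.

(** Write [A = K *m K^H] with [K] a unitary times the square roots of the eigenvalues, diagonalize
    the congruent of [B] by the inverse of [K] with a unitary [V], and take [G = K *m V]. *)
Lemma posdef_simul_diagonalize n (A B : 'M[D]_n) : posdef A -> posdef B ->
  exists2 G : 'M[D]_n, exists H, inverse_of G H &
  exists2 g, forall i, 0 < g i & A = G *m G^H /\ B = G *m rdiag g *m G^H.
Proof.
move=> /posdef_diagonalize[U invU [l l0 AU]] pB.
have s0 i : Num.sqrt (l i) != 0 by rewrite gt_eqF// sqrtr_gt0.
pose K := U *m rdiag (fun i => Num.sqrt (l i)).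
have [K' invK] : exists K', inverse_of K K'.
  by eexists; apply: inverse_of_mul invU (rdiag_inverse s0).
have AK : A = K *m K^H.
  rewrite AU /K ctransmxM ctransmx_rdiag !mulmxA -[in RHS](mulmxA U) rdiagM.
  by congr (_ *m _ *m _); apply: eq_rdiag => i; rewrite -expr2 sqr_sqrtr// ltW.
have invK' : inverse_of K' K by case: invK.
have [V invV [m m0 BV]] := posdef_diagonalize (posdef_congr invK' pB).
exists (K *m V); first by eexists; apply: inverse_of_mul invK invV.
exists m => //; rewrite ctransmxM; split.
  by rewrite mulmxA -(mulmxA K); have [-> _] := invV; rewrite mulmx1.
have [KK' _] := invK; have [_ KK'H] := inverse_of_ctransmx invK.
rewrite !mulmxA -(mulmxA K V) -(mulmxA K) -BV !mulmxA KK' mul1mx -mulmxA.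
by rewrite KK'H mulmx1.
Qed.

(** * Means on simultaneously diagonal matrices *)

Section MeanFormula.
Variables (n : nat) (sigma : 'M[D]_n -> 'M[D]_n -> 'M[D]_n) (f : R -> R).
Hypotheses (ka : kubo_ando_mean sigma) (rep : representing_function sigma f).

(** The representing formula is applied only here, where both square root factors are the identity;
    other pairs are reached by congruence. *)
Lemma mean_1_rdiag (g : 'I_n -> R) : (forall i, 0 < g i) ->
  sigma 1%:M (rdiag g) = rdiag (fun i => f (g i)).
Proof.
move=> g0; rewrite (repr_mean rep (posdef1 n)); last exact/posdef_rdiag.
have -> : msqrt 1%:M = 1%:M :> 'M[D]_n.
  by rewrite -{1}rdiag1 /msqrt mfun_rdiag sqrtr1 rdiag1.
have -> : misqrt 1%:M = 1%:M :> 'M[D]_n.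
  by rewrite -{1}rdiag1 /misqrt mfun_rdiag sqrtr1 invr1 rdiag1.
by rewrite !mul1mx !mulmx1 mfun_rdiag.
Qed.

Lemma mean_congr_rdiag (G : 'M[D]_n) (g : 'I_n -> R) :
  (exists H, inverse_of G H) -> (forall i, 0 < g i) ->
  sigma (G *m G^H) (G *m rdiag g *m G^H) = G *m rdiag (fun i => f (g i)) *m G^H.
Proof.
move=> invG g0; have pg : posdef (rdiag g) by exact/posdef_rdiag.
rewrite -mean_1_rdiag// (mean_congruence ka)//; last exact: posdef1.
by rewrite mulmx1.
Qed.

(** Absorbing the square roots of [l] into [G] reduces to the case where the first diagonal is the
    identity. *)
Lemma mean_rdiag (G : 'M[D]_n) (l g : 'I_n -> R) :
  (exists H, inverse_of G H) -> (forall i, 0 < l i) -> (forall i, 0 < g i) ->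
  sigma (G *m rdiag l *m G^H) (G *m rdiag g *m G^H)
    = G *m rdiag (fun i => l i * f (g i / l i)) *m G^H.
Proof.
move=> [H invG] l0 g0.
have s0 i : Num.sqrt (l i) != 0 by rewrite gt_eqF// sqrtr_gt0.
pose s := rdiag (fun i => Num.sqrt (l i)).
have E (h : 'I_n -> R) : G *m rdiag (fun i => l i * h i) *m G^H
    = (G *m s) *m rdiag h *m (G *m s)^H.
  rewrite ctransmxM ctransmx_rdiag !mulmxA -(mulmxA _ (rdiag h)) -(mulmxA _ s) !rdiagM.
  congr (_ *m _ *m _); apply: eq_rdiag => i.
  by rewrite mulrCA -expr2 sqr_sqrtr 1?mulrC// ltW.
have -> : rdiag l = rdiag (fun i => l i * 1) by apply: eq_rdiag => i; rewrite mulr1.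
have -> : rdiag g = rdiag (fun i => l i * (g i / l i)).
  by apply: eq_rdiag => i; rewrite mulrC divfK// gt_eqF.
rewrite !E rdiag1 mulmx1 mean_congr_rdiag//.
- by eexists; apply: inverse_of_mul invG (rdiag_inverse s0).
- by move=> i; rewrite divr_gt0.
Qed.

End MeanFormula.

Lemma rdiagB n (g h : 'I_n -> R) : rdiag g - rdiag h = rdiag (fun i => g i - h i).
Proof.
apply/matrixP => i j; rewrite !mxE -mulrnBl -rmorphB.
by congr (of_real D _ *+ _).
Qed.

Lemma loewner_refl n (A : 'M[D]_n) : loewner A A.
Proof.
move=> x; exists 0 => //.
by rewrite subrr /qform mulmx0 mul0mx mxE rmorph0.
Qed.

Lemma loewner_rdiag n (g h : 'I_n -> R) :
  loewner (rdiag g) (rdiag h) <-> forall i, g i <= h i.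
Proof.
split=> [gh i|gh x].
  have [r r0] := gh (delta_mx i 0).
  by rewrite rdiagB qform_rdiag_delta => /of_real_inj gh_r; rewrite -subr_ge0 gh_r.
rewrite rdiagB qform_rdiag; eexists; last by [].
by apply: sumr_ge0 => i _; rewrite mulr_ge0 ?(normsq_ge0 S)// subr_ge0.
Qed.

(* The two sides of each comparison have spectra x, y, respectively g(x), g(y),
   relative to the common diag(a) = G diag(c) G^H.  Asking only for a congruence
   G, instead of a unitary, keeps square roots out of the 2 x 2 case below. *)
Definition transport n (g : R -> R) := forall (G : 'M[D]_n) (a c x y : 'I_n -> R),
  (exists H, inverse_of G H) ->
  (forall i, 0 < a i) -> (forall i, 0 < c i) ->
  (forall i, 0 < x i) -> (forall i, 0 < y i) ->
  rdiag a = G *m rdiag c *m G^H ->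
  loewner (rdiag (fun i => a i * x i)) (G *m rdiag (fun i => c i * y i) *m G^H) ->
  loewner (rdiag (fun i => a i * g (x i))) (G *m rdiag (fun i => c i * g (y i)) *m G^H).

Section MeanTransport.
Variables (n : nat) (sigma : 'M[D]_n -> 'M[D]_n -> 'M[D]_n) (f : R -> R).
Hypotheses (ka : kubo_ando_mean sigma) (rep : representing_function sigma f).

(** The common matrix [rdiag a] is the first argument of [sigma], and monotonicity is used in the
    second. *)
Lemma transport_repr : transport n f.
Proof.
move=> G a c x y invG a0 c0 x0 y0 aG le_xy.
have pos (u v : 'I_n -> R) : (forall i, 0 < u i) -> (forall i, 0 < v i) ->
  forall i, 0 < u i * v i by move=> u0 v0 i; exact: mulr_gt0.
have fE (u v : 'I_n -> R) : (forall i, 0 < u i) ->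
    rdiag (fun i => u i * f (v i)) = rdiag (fun i => u i * f (u i * v i / u i)).
  by move=> u0; apply: eq_rdiag => i; rewrite mulrAC divff ?mul1r// gt_eqF.
rewrite (fE a x)// (fE c y)// -(mean_rdiag ka rep invG c0 (pos _ _ c0 y0)) -aG.
have := mean_rdiag ka rep (inverse_of1 n) a0 (pos _ _ a0 x0).
rewrite ctransmx1 !mul1mx !mulmx1 => <-.
case: invG => H GH.
apply: (mean_monotone ka) => //; [exact/posdef_rdiag..| | |exact: loewner_refl].
  exact/posdef_rdiag/pos.
by apply: posdef_congr GH _; exact/posdef_rdiag/pos.
Qed.

(** The common matrix [rdiag a] is now the second argument, and monotonicity is used in the
    first. *)
Lemma transport_transpose : transport n (fun t => t * f t^-1).
Proof.
move=> G a c x y invG a0 c0 x0 y0 aG le_xy.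
have pos (u v : 'I_n -> R) : (forall i, 0 < u i) -> (forall i, 0 < v i) ->
  forall i, 0 < u i * v i by move=> u0 v0 i; exact: mulr_gt0.
have fE (u v : 'I_n -> R) : (forall i, 0 < u i) ->
    rdiag (fun i => u i * (v i * f (v i)^-1))
    = rdiag (fun i => u i * v i * f (u i / (u i * v i))).
  by move=> u0; apply: eq_rdiag => i; rewrite invfM mulVKf ?mulrA// gt_eqF.
rewrite (fE a x)// (fE c y)// -(mean_rdiag ka rep invG (pos _ _ c0 y0) c0) -aG.
have := mean_rdiag ka rep (inverse_of1 n) (pos _ _ a0 x0) a0.
rewrite ctransmx1 !mul1mx !mulmx1 => <-.
case: invG => H GH.
apply: (mean_monotone ka) => //; [| |exact/posdef_rdiag..|exact: loewner_refl].
  exact/posdef_rdiag/pos.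
by apply: posdef_congr GH _; exact/posdef_rdiag/pos.
Qed.

End MeanTransport.

(** * From transport to scalar inequalities *)

Lemma transport_nondecreasing n g : transport n.+1 g -> nondecreasing_on_pos g.
Proof.
move=> tr s t s0 st; have t0 := lt_le_trans s0 st.
have := tr 1%:M (fun=> 1) (fun=> 1) (fun=> s) (fun=> t).
rewrite ctransmx1 !mul1mx !mulmx1.
move=> /(_ (inverse_of1 _) (fun=> ltr01) (fun=> ltr01) (fun=> s0) (fun=> t0) erefl).
rewrite !loewner_rdiag => /(_ _)/(_ ord0); rewrite !mul1r; exact.
Qed.

Lemma qform_real n (M : 'M[R]_n) (u : 'cV[R]_n) :
  qform (M%:D) (u%:D) = of_real D ((u^T *m M *m u) 0 0).
Proof. by rewrite /qform ctransmx_real -!map_mxM mxE. Qed.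

(* With x = (p, r), y = (q, s) and the Cauchy matrix C = (1 / (y_j - x_i)), the
   weights rows and cols are those for which diag(rows) = C diag(cols) C^T and
   diag(rows x) + e e^T = C diag(cols y) C^T, where e = (1, 1)^T. *)
Section CauchyTransport.
Variables (m : nat) (p q r s : R).
Hypotheses (pq : p < q) (qr : q < r) (rs : r < s).

Let vec2 (u v : R) : 'rV[R]_2 := \row_j [:: u; v]`_j.
Let extend (u : 'rV[R]_2) : 'rV[R]_(2 + m) := row_mx u (const_mx 1).
Let block (M : 'M[R]_2) t : 'M[R]_(2 + m) := block_mx M 0 0 t%:M.
Let cauchy : 'M[R]_2 := \matrix_(i, j) (vec2 q s 0 j - vec2 p r 0 i)^-1.
Let rows := vec2 ((r - p) / ((q - p) * (s - p))) ((r - p) / ((r - q) * (s - r))).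
Let cols := vec2 ((q - p) * (r - q) / (s - q)) ((s - p) * (s - r) / (s - q)).

Let qp_gt0 : 0 < q - p. Proof. by rewrite subr_gt0. Qed.
Let rq_gt0 : 0 < r - q. Proof. by rewrite subr_gt0. Qed.
Let sr_gt0 : 0 < s - r. Proof. by rewrite subr_gt0. Qed.
Let rp_gt0 : 0 < r - p. Proof. by rewrite subr_gt0 (lt_trans pq). Qed.
Let sq_gt0 : 0 < s - q. Proof. by rewrite subr_gt0 (lt_trans qr). Qed.
Let sp_gt0 : 0 < s - p. Proof. by rewrite subr_gt0 (lt_trans pq) // -subr_gt0. Qed.
Let qr_neq0 : q - r != 0. Proof. by rewrite subr_eq0 lt_eqF. Qed.
Let neq0 := (gt_eqF qp_gt0, gt_eqF rq_gt0, gt_eqF sr_gt0, gt_eqF sq_gt0,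
  gt_eqF sp_gt0, qr_neq0).

Let I2_case (P : 'I_2 -> Prop) : P 0 -> P 1 -> forall i, P i.
Proof.
by move=> P0 P1 [[|[|//]] i]; [move: P0|move: P1]; congr P; apply: val_inj.
Qed.

Let cauchy_conj (w : 'rV[R]_2) i k : (cauchy *m diag_mx w *m cauchy^T) i k =
  cauchy i 0 * w 0 0 * cauchy k 0 + cauchy i 1 * w 0 1 * cauchy k 1.
Proof.
rewrite mxE !big_ord_recl big_ord0 addr0 mul_mx_diag !mxE.
by rewrite (_ : lift _ _ = 1 :> 'I_2)//; apply: val_inj.
Qed.

Let cauchy_rows : cauchy *m diag_mx cols *m cauchy^T = diag_mx rows.
Proof.
apply/matrixP; apply: I2_case; apply: I2_case;
  by rewrite cauchy_conj !mxE /=; field; rewrite !neq0.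
Qed.

Let cauchy_shift :
  cauchy *m diag_mx (\row_i (cols 0 i * vec2 q s 0 i)) *m cauchy^T =
  diag_mx (\row_i (rows 0 i * vec2 p r 0 i)) + const_mx 1 *m (const_mx 1 : 'cV_2)^T.
Proof.
apply/matrixP; apply: I2_case; apply: I2_case;
  by rewrite cauchy_conj !mxE big_ord1 !mxE /=; field; rewrite !neq0.
Qed.

Let extend_gt0 u v : 0 < u -> 0 < v -> forall i, 0 < extend (vec2 u v) 0 i.
Proof.
move=> u0 v0 i; rewrite mxE; case: splitP => j _; rewrite mxE ?ltr01//.
by case: j => -[|[|//]].
Qed.

(** Weights and spectral values are padded by 1, so the part outside the 2 x 2 block is the scalar
    matrix [phi 1]. *)
Let rdiag_extend phi u v :
  rdiag (fun i => extend u 0 i * phi (extend v 0 i)) =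
  (block (diag_mx (\row_i (u 0 i * phi (v 0 i)))) (phi 1))%:D.
Proof.
rewrite /block -diag_const_mx -diag_mx_row /rdiag real_diagE; congr (diag_mx _)%:D.
by apply/rowP => i; rewrite !mxE; case: splitP => j _; rewrite !mxE ?mul1r.
Qed.

Let block_conj w t :
  (block cauchy 1)%:D *m (block (diag_mx w) t)%:D *m ((block cauchy 1)%:D)^H
  = (block (cauchy *m diag_mx w *m cauchy^T) t)%:D.
Proof.
rewrite ctransmx_real -!map_mxM /block tr_block_mx !mulmx_block; congr (block_mx _ _ _ _)%:D;
  by rewrite ?trmx0 ?trmx1 ?(mul0mx, mulmx0, mul1mx, mulmx1, addr0, add0r).
Qed.

Let quad2 (M : 'M[R]_2) u v : ((vec2 u v) *m M *m (vec2 u v)^T) 0 0 =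
  M 0 0 * u ^+ 2 + (M 0 1 + M 1 0) * (u * v) + M 1 1 * v ^+ 2.
Proof.
rewrite !(mxE, big_ord_recl, big_ord0) /= (_ : lift _ _ = 1 :> 'I_2); first by ring.
exact: val_inj.
Qed.

(** Transport is applied to the pair that differs by the positive rank one matrix [e *m e^T]. The
    resulting comparison, tested on vectors supported in the 2 x 2 block, is the hypothesis of
    [four_point_of_psd]. *)
Lemma four_point_of_transport g : 0 < p -> transport (2 + m) g ->
  (g s - g p) * (g r - g q) * ((q - p) * (s - r))
    <= (g q - g p) * (g s - g r) * ((s - p) * (r - q)).
Proof.
move=> p_gt0 tr; apply: four_point_of_psd => // u v.
have [q0 r0 s0] : [/\ 0 < q, 0 < r & 0 < s].
  by split; rewrite (lt_trans p_gt0)// -subr_gt0.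
have extend1 w : rdiag (extend w 0) = (block (diag_mx w) 1)%:D.
  transitivity (rdiag (fun i => extend w 0 i * 1)).
    by apply: eq_rdiag => i; rewrite mulr1.
  rewrite (rdiag_extend (fun=> 1) w w); congr (block (diag_mx _) _)%:D.
  by apply/rowP => i; rewrite mxE mulr1.
have a0 i : 0 < extend rows 0 i by apply: extend_gt0; rewrite divr_gt0 ?mulr_gt0.
have c0 i : 0 < extend cols 0 i by apply: extend_gt0; rewrite divr_gt0 ?mulr_gt0.
pose G := (block cauchy 1)%:D.
have rowsG : rdiag (extend rows 0) = G *m rdiag (extend cols 0) *m G^H.
  by rewrite !extend1 block_conj cauchy_rows.
have invG : exists H, inverse_of G H.
  (* Dividing [rowsG] by its invertible left side exhibits a right inverse of [G]. *)
  pose H := rdiag (extend cols 0) *m G^H *m rdiag (fun i => (extend rows 0 i)^-1).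
  exists H; suff GH : G *m H = 1%:M.
    by split=> //; exact: mulmx1C_star.
  rewrite /H !mulmxA -rowsG rdiagM -rdiag1; apply: eq_rdiag => i.
  by rewrite divff// gt_eqF.
have := tr G _ _ _ _ invG a0 c0 (extend_gt0 p_gt0 r0) (extend_gt0 q0 s0) rowsG.
rewrite (rdiag_extend id) (rdiag_extend id) !rdiag_extend !block_conj cauchy_shift.
set L := loewner _ _; have hL : L.
  move=> z.
  pose e : 'cV[R]_(2 + m) := col_mx (const_mx 1) 0.
  (* The difference of the two matrices is [e *m e^T], whose quadratic form at [z] is this squared
     norm. *)
  exists (colnormsq ((e%:D)^H *m z)); first exact: colnormsq_ge0.
  rewrite -map_mxB /block opp_block_mx add_block_mx !subrr addrAC subrr add0r.
  have -> : block_mx (const_mx 1 *m (const_mx 1 : 'cV[R]_2)^T) 0 0 0 = e *m e^T.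
    by rewrite tr_col_mx mul_col_row trmx0 !mulmx0 mul0mx.
  rewrite /qform [X in _ *m X *m _]map_mxM -ctransmx_real -mulmxA -mulmxA mulmxA.
  rewrite -{1}[e%:D]ctransmxK -ctransmxM colnormsqE.
  by rewrite mxE eqxx mulr1n.
pose w := vec2 u v.
move=> /(_ hL (col_mx w^T 0)%:D)[t t0].
rewrite -map_mxB qform_real => /of_real_inj tE; move: t0; rewrite -{}tE.
rewrite /block opp_block_mx add_block_mx tr_col_mx trmxK mul_row_block trmx0 !mul0mx !addr0.
rewrite mul_row_col mulmx0 addr0 quad2 => M0; rewrite -subr_ge0; move: M0.
have subE (M N : 'M[R]_2) i j : (M + - N) i j = M i j - N i j by rewrite !mxE.
by congr (0 <= _); rewrite !subE !cauchy_conj !mxE /=; ring.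
Qed.

End CauchyTransport.

(** * Linearizability and spectrum in simultaneously diagonal form *)

Lemma rdiag_inj n (g h : 'I_n -> R) : rdiag g = rdiag h -> g =1 h.
Proof.
move=> /matrixP gh i; have := gh i i; rewrite !mxE eqxx !mulr1n.
exact: of_real_inj.
Qed.

Lemma congr_mx_inj n (G H : 'M[D]_n) : inverse_of G H ->
  injective (fun X => G *m X *m G^H).
Proof.
move=> invG X Y /= XY.
have [_ HG] := invG; have [GH' _] := inverse_of_ctransmx invG.
have cancel Z : Z = H *m (G *m Z *m G^H) *m H^H.
  by rewrite !mulmxA HG mul1mx -mulmxA GH' mulmx1.
by rewrite [X]cancel XY -cancel.
Qed.

Section SimultaneouslyDiagonal.
Variables (n : nat) (A B G H : 'M[D]_n) (g : 'I_n -> R).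
Hypotheses (invG : inverse_of G H) (AG : A = G *m G^H) (BG : B = G *m rdiag g *m G^H).

(** The mean and the combination of [A] and [B] are congruent through [G] to diagonal matrices,
    compared entry by entry. The coefficient of [A] becomes the intercept and that of [B] the slope,
    hence the swapped witnesses. *)
Lemma linearizable_rdiag sigma f :
  kubo_ando_mean sigma -> representing_function sigma f -> (forall i, 0 < g i) ->
  linearizable sigma A B <-> exists a b, forall i, f (g i) = a * g i + b.
Proof.
move=> ka rep g0.
have sE : sigma A B = G *m rdiag (fun i => f (g i)) *m G^H.
  by rewrite AG BG (mean_congr_rdiag ka rep)//; exists H.
have lE a b : of_real D a *: A + of_real D b *: B
    = G *m rdiag (fun i => b * g i + a) *m G^H.
  have -> : rdiag (fun i => b * g i + a) = of_real D b *: rdiag g + of_real D a *: 1%:M.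
    apply/matrixP => i j; rewrite !mxE rmorphD rmorphM.
    by case: (i == j); rewrite /= ?mulr1n ?mulr1 // !mulr0n !mulr0 addr0.
  by rewrite mulmxDr !scalemx_realAr mulmx1 mulmxDl -!scalemxAl -AG -BG addrC.
split=> [[a [b]]|[a [b fg]]].
  rewrite sE lE => /(congr_mx_inj invG)/rdiag_inj fg.
  by exists b, a.
by exists b, a; rewrite sE lE; congr (_ *m _ *m _); apply: eq_rdiag.
Qed.

(** In the coordinates [G^H *m v] the eigenvalue equation becomes diagonal. At a nonzero coordinate
    the real entry [g i] commutes past it and cancellation gives [lambda], so right eigenvalues are
    real even over the quaternions. *)
Lemma Spec_rdiag : Spec (minv A *m B) = range (fun i => of_real D (g i)).
Proof.
have invGH := inverse_of_ctransmx invG.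
have [AK KA] : inverse_of A (minv A).
  have invA : [set X | inverse_of A X] (H^H *m H).
    by rewrite /= AG; exact: inverse_of_mul.
  exact: (xgetPex 0 (ex_intro _ _ invA)).
have SpecE lambda (v : 'cV[D]_n) : minv A *m B *m v = v *m lambda%:M <->
    rdiag g *m (G^H *m v) = G^H *m v *m lambda%:M.
  have [_ HG] := invG; split=> [/(congr1 (mulmx A))|E].
    rewrite !mulmxA AK mul1mx BG AG => /(congr1 (mulmx H)).
    by rewrite !mulmxA HG !mul1mx.
  by rewrite -mulmxA BG -!mulmxA E !mulmxA -(mulmxA _ G) -AG KA mul1mx.
have [GH' HG'] := invGH.
apply/seteqP; split=> [lambda [v v0 /SpecE]|_ [i _ <-]].
  move uE : (G^H *m v) => u ug.
  have /existsP[i ui] : [exists i, u i 0 != 0].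
    apply: contraNT v0; rewrite negb_exists => /forallP u0.
    apply/eqP; rewrite -[v]mul1mx -HG' -mulmxA uE.
    have -> : u = 0.
      by apply/matrixP => i j; rewrite ord1 mxE; apply/eqP; rewrite -[_ == _]negbK.
    by rewrite mulmx0.
  exists i => //; apply/eqP; rewrite -subr_eq0; apply/eqP.
  apply: mul_normsq_eq0 ui; rewrite mulrBr -(of_realC S).
  have /matrixP/(_ i 0) := ug.
  by rewrite mul_diag_mx !mxE big_ord1 !mxE eqxx mulr1n => ->; rewrite subrr.
have GHi : G^H *m (H^H *m delta_mx i 0) = delta_mx i 0 :> 'cV[D]_n.
  by rewrite mulmxA GH' mul1mx.
exists (H^H *m delta_mx i 0).
  apply/eqP => /(congr1 (mulmx G^H)); rewrite GHi mulmx0.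
  by move=> /matrixP/(_ i 0)/eqP; rewrite !mxE !eqxx oner_eq0.
apply/SpecE; rewrite GHi mulmx_real_scalar; apply/matrixP => k j.
rewrite ord1 mul_diag_mx !mxE.
by have [->|] := eqVneq k i; rewrite /= ?mulr0.
Qed.

End SimultaneouslyDiagonal.

(** This dichotomy stands in for counting: two values are interpolated by a line, three ordered ones
    feed the affine criterion. *)
Lemma two_values_or_three n (g : 'I_n -> R) :
  (exists x y, forall k, g k = x \/ g k = y) \/ exists i j k, g i < g j /\ g j < g k.
Proof.
have [[i [j ij]]|const] := pselect (exists i j, g i < g j); last first.
  left; case: n g const => [|n] g const; first by exists 0, 0; case.
  exists (g ord0), (g ord0) => k; left.
  by case: (ltgtP (g k) (g ord0)) => // lt; case: const; [exists k, ord0|exists ord0, k].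
have [[k [ki kj]]|two] := pselect (exists k, g k <> g i /\ g k <> g j); last first.
  left; exists (g i), (g j) => k; apply: contrapT => /not_orP[ki kj].
  by apply: two; exists k.
right; have [ki'|ik|//] := ltgtP (g k) (g i); first by exists k, i, j.
by have [kj'|jk|//] := ltgtP (g k) (g j); [exists i, k, j|exists i, j, k].
Qed.

(** Two distinct indices guarantee size at least 2, hence room for the Cauchy block. *)
Lemma four_point_repr n (sigma : 'M[D]_n -> 'M[D]_n -> 'M[D]_n) f (i j : 'I_n) :
  kubo_ando_mean sigma -> representing_function sigma f -> i != j ->
  [/\ nondecreasing_on_pos f, four_point f,
    nondecreasing_on_pos (fun t => t * f t^-1) & four_point (fun t => t * f t^-1)].
Proof.
case: n => [|[|m]] in sigma i j * => ka rep.
- by case: i.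
- by rewrite (ord1 i) (ord1 j) eqxx.
have trf := transport_repr ka rep; have trt := transport_transpose ka rep.
move=> _; split.
- exact: transport_nondecreasing trf.
- by move=> p q r s p0 pq qr rs; exact: (@four_point_of_transport m _ _ _ _ pq qr rs _ p0 trf).
- exact: transport_nondecreasing trt.
- by move=> p q r s p0 pq qr rs; exact: (@four_point_of_transport m _ _ _ _ pq qr rs _ p0 trt).
Qed.

Lemma linearizable_iff_card_Spec n (A B : 'M[D]_n) sigma f :
  posdef A -> posdef B -> kubo_ando_mean sigma -> representing_function sigma f ->
  ~ affine_on_pos f -> linearizable sigma A B <-> (Spec (minv A *m B) #<= `I_2).
Proof.
move=> pA pB ka rep naff.
have [G [H invG] [g g0 [AG BG]]] := posdef_simul_diagonalize pA pB.
rewrite (linearizable_rdiag invG AG BG ka rep g0) (Spec_rdiag invG AG BG).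
split=> [[a [b fg]]|card2].
  have [[x [y gxy]]|[i [j [k [ij jk]]]]] := two_values_or_three g.
    (* The spectrum lies in the image of [I_2] under [h], whether or not [x] and [y] differ. *)
    pose h (l : nat) := if l == 0 then of_real D x else of_real D y.
    apply: card_le_trans (card_image_le h `I_2); apply: subset_card_le.
    by move=> _ [i _ <-]; case: (gxy i) => ->; [exists 0|exists 1].
  (* Three spectral values on one line would make [f] affine on the whole half-line. *)
  case: naff; exists a, b.
  have neq_ij : i != j by apply: contraTneq ij => ->; rewrite ltxx.
  have [f1 f2 t1 t2] := four_point_repr ka rep neq_ij.
  exact: (affine_of_transpose f1 f2 t1 t2 (g0 i) ij jk).
have [[x [y gxy]]|[i [j [k [ij jk]]]]] := two_values_or_three g.
  have [xy|xy] := eqVneq x y.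
    exists 0, (f x) => i; rewrite mul0r add0r.
    by case: (gxy i) => ->; rewrite ?xy.
  exists ((f x - f y) / (x - y)), (f x - (f x - f y) / (x - y) * x) => i.
  have xy0 : x - y != 0 by rewrite subr_eq0.
  by case: (gxy i) => ->; field.
(* The third value [g k] is the default of [nth], reached at index 2; [h] thus embeds three points
   in the spectrum. *)
pose h (l : nat) := of_real D (nth (g k) [:: g i; g j] l).
suff : `I_3 #<= `I_2 by rewrite card_le_II.
apply: card_le_trans card2.
have ik := lt_trans ij jk.
have hinj : {in `I_3 &, injective h}.
  move=> l l'; rewrite !inE => l3 l'3 /of_real_inj.
  by case: l l' l3 l'3 => [|[|[|//]]] [|[|[|//]]] //= _ _ /eqP;
    rewrite ?(lt_eqF ij, gt_eqF ij, lt_eqF jk, gt_eqF jk, lt_eqF ik, gt_eqF ik).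
rewrite -(card_le_eql (inj_card_eq hinj)); apply: subset_card_le.
by move=> _ [[|[|l]] _ <-]; [exists i|exists j|exists k => //; rewrite /h /= nth_nil].
Qed.

End StarMatrices.

Theorem theorem3p3 (R : realType) (k : algebra_kind) (n : nat)
    (A B : 'M[scalars_of R k]_n)
    (sigma : 'M[scalars_of R k]_n -> 'M[scalars_of R k]_n ->
             'M[scalars_of R k]_n)
    (f : R -> R) :
  posdef A -> posdef B ->
  kubo_ando_mean sigma -> representing_function sigma f ->
  ~ affine_on_pos f ->
  (linearizable sigma A B <-> (Spec (minv A *m B) #<= `I_2)).
Proof.
move=> pA pB ka rep naff.
exact: (linearizable_iff_card_Spec (scalars_star_division_algebra R k)) pA pB ka rep naff.
Qed.
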